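(* In the following setting: $p$ an odd prime, $N\ge1$ with $p\nmid N$, $\Lambda=\mathcal{O}[\![T]\!]$, $\mathbf{H}^{\mathrm{ord}}$ Hida's universal $p$-ordinary $\Lambda$-adic Hecke algebra of tame level $N$; $\mathbf{I}_1,\dots,\mathbf{I}_m$ reduced irreducible components of $\mathbf{H}^{\mathrm{ord}}$; $M$ the integral closure of $\Lambda$ in a finite Galois extension of $\mathrm{Frac}(\Lambda)$ with embeddings $e_i:\mathbf{I}_i\to M$; $R$ an infinite set of classical weight one eigenforms each having exactly $m$ Galois conjugates over its character field; for each $f\in R$ an ordering $f_1=f,\dots,f_m$ of these conjugates and a $\overline{\mathbf{Q}}_p$-point $P_f$ of $M$ such that $P_f\circ e_i$ is a point of $\mathbf{I}_i$ whose specialization is the Hecke eigensystem of $f_i$; $r:G_{\mathbf{Q}}\to\mathrm{GL}_{2m}(\mathrm{Frac}(M))$ the direct sum of the $\rho_{\mathbf{I}_i}$ via the $e_i$, with image in $\mathrm{GL}_{2m}(M_{P_f})$ for every $f\in R$, and $r_f=P_f\circ r$ (which equals $\bigoplus_i\rho_{f_i,p}$). Then for every $f\in R$ and every prime $\ell\nmid Np$, the characteristic polynomial $A_\ell(P_f)(X)=\det(XI-r_f(\mathrm{Frob}_\ell))$ has coefficients in the character field $\mathbf{Q}(\epsilon)$ of $f$.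
   Context: $\mathbf{H}^{\mathrm{ord}}$ is a commutative $\Lambda$-algebra, finite free as $\Lambda$-module, generated by $T_\ell,S_\ell$ ($\ell\nmid Np$), $U_\ell$ ($\ell\mid Np$), interpolating ordinary Hecke algebras; components are quotients by minimal primes; $\rho_{\mathbf{J}}$ is Hida's Galois representation attached to a component $\mathbf{J}$, unramified outside $Np$, specializing at classical points to the $p$-adic Galois representation $\rho_{f,p}$ of the corresponding eigenform. The character field of $f$ with Nebentypus $\epsilon$ is $\mathbf{Q}(\epsilon)=\mathbf{Q}(\{\epsilon(x)\})$; Galois conjugates of $f$ over it are the eigenforms $f^\sigma$, $\sigma\in G_{\mathbf{Q}(\epsilon)}$, whose Hecke eigenvalues are $\sigma$ applied to those of $f$. $M_{P_f}$ is the localization of $M$ at $\ker P_f$. *)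

(* Defs.v *)
From HB Require Import structures.
From mathcomp Require Import all_boot all_order all_algebra all_field.
From mathcomp Require Import complex fraction ring_quotient.
From mathcomp Require Import all_classical all_reals all_analysis.

Set Implicit Arguments.
Unset Strict Implicit.
Unset Printing Implicit Defensive.

Import Order.TTheory GRing.Theory Num.Theory.
Import numFieldNormedType.Exports.

Local Open Scope ring_scope.

Record fps (R : Type) := Fps { fps_coef : nat -> R }.

HB.instance Definition _ (R : Type) := gen_eqMixin (fps R).
HB.instance Definition _ (R : Type) := gen_choiceMixin (fps R).

Lemma fpsP (R : Type) (f g : fps R) : fps_coef f =1 fps_coef g -> f = g.
Proof. by case: f g => [f] [g] /= /funext ->. Qed.

Section FpsRing.
Variable R : comNzRingType.
Implicit Types f g h : fps R.

Definition fpsC (c : R) : fps R := Fps (fun n => if n == 0%N then c else 0).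
Definition fpsX : fps R := Fps (fun n => (n == 1%N)%:R).
Definition fps_add f g : fps R := Fps (fun n => fps_coef f n + fps_coef g n).
Definition fps_opp f : fps R := Fps (fun n => - fps_coef f n).
Definition fps_mul f g : fps R :=
  Fps (fun n => \sum_(i < n.+1) fps_coef f i * fps_coef g (n - i)%N).

Fact fps_addA : associative fps_add.
Proof. by move=> f g h; apply: fpsP => n /=; rewrite addrA. Qed.
Fact fps_addC : commutative fps_add.
Proof. by move=> f g; apply: fpsP => n /=; rewrite addrC. Qed.
Fact fps_add0 : left_id (fpsC 0) fps_add.
Proof. by move=> f; apply: fpsP => n /=; rewrite if_same add0r. Qed.
Fact fps_addN : left_inverse (fpsC 0) fps_opp fps_add.
Proof. by move=> f; apply: fpsP => n /=; rewrite if_same addNr. Qed.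

HB.instance Definition _ :=
  GRing.isZmodule.Build (fps R) fps_addA fps_addC fps_add0 fps_addN.

Definition fps_trunc d f : {poly R} := \poly_(i < d) fps_coef f i.

Lemma coef_trunc d f i : (i < d)%N -> (fps_trunc d f)`_i = fps_coef f i.
Proof. by move=> lid; rewrite coef_poly lid. Qed.

Lemma coef_fps_mul d f g n : (n < d)%N ->
  fps_coef (fps_mul f g) n = (fps_trunc d f * fps_trunc d g)`_n.
Proof.
move=> lnd; rewrite coefM /=; apply: eq_bigr => i _.
by rewrite !coef_trunc // ?(leq_ltn_trans (leq_subr _ _)) //
           (leq_trans (ltn_ord i)).
Qed.

Lemma coef_trunc_mul d f g (q : {poly R}) n : (n < d)%N ->
  (fps_trunc d (fps_mul f g) * q)`_n = (fps_trunc d f * fps_trunc d g * q)`_n.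
Proof.
move=> lnd; rewrite !coefM; apply: eq_bigr => i _.
have lid : (i < d)%N by apply: leq_trans (ltn_ord i) _.
by rewrite coef_trunc // (@coef_fps_mul d).
Qed.

Fact fps_mulC : commutative fps_mul.
Proof.
by move=> f g; apply: fpsP => n; rewrite !(@coef_fps_mul n.+1) // mulrC.
Qed.
Fact fps_mulA : associative fps_mul.
Proof.
move=> f g h; apply: fpsP => n; rewrite !(@coef_fps_mul n.+1) //.
by rewrite mulrC !coef_trunc_mul // mulrC mulrA.
Qed.
Fact fps_mul1 : left_id (fpsC 1) fps_mul.
Proof.
move=> f; apply: fpsP => n /=; rewrite big_ord_recl /= subn0 mul1r.
by rewrite big1 ?addr0 // => i _; rewrite mul0r.
Qed.
Fact fps_mulDl : left_distributive fps_mul fps_add.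
Proof.
move=> f g h; apply: fpsP => n /=; rewrite -big_split /=.
by apply: eq_bigr => i _; rewrite mulrDl.
Qed.
Fact fps_1neq0 : fpsC 1 != 0 :> fps R.
Proof.
by apply/eqP => /(congr1 (fun f => fps_coef f 0)) /= /eqP; rewrite oner_eq0.
Qed.

HB.instance Definition _ := GRing.Zmodule_isComNzRing.Build (fps R)
  fps_mulA fps_mulC fps_mul1 fps_mulDl fps_1neq0.

Definition fps_unit : {pred fps R} := fun f => `[< exists g, g * f = 1 >].
Definition fps_inv f : fps R :=
  if pselect (exists g, g * f = 1) is left h then projT1 (cid h) else f.

Fact fps_mulV : {in fps_unit, left_inverse 1 fps_inv *%R}.
Proof.
move=> f /asboolP ex; rewrite /fps_inv.
by case: pselect => // h; case: (cid h).
Qed.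
Fact fps_unitP f g : g * f = 1 -> fps_unit f.
Proof. by move=> e; apply/asboolP; exists g. Qed.
Fact fps_inv_out : {in [predC fps_unit], fps_inv =1 id}.
Proof.
by move=> f /asboolP nex; rewrite /fps_inv; case: pselect.
Qed.

HB.instance Definition _ := GRing.ComNzRing_hasMulInverse.Build (fps R)
  fps_mulV fps_unitP fps_inv_out.

End FpsRing.

Section FpsDomain.
Variable R : idomainType.

Fact fps_integral (f g : fps R) : f * g = 0 -> (f == 0) || (g == 0).
Proof.
move=> fg0; apply/negPn/negP; rewrite negb_or => /andP[f0 g0].
have ex (h : fps R) : h != 0 -> exists n, fps_coef h n != 0.
  move=> h0; apply/not_existsP => all0; case/eqP: h0; apply: fpsP => n /=.
  by rewrite if_same; apply/eqP/negPn/negP; apply: all0.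
case: (ex_minnP (ex f f0)) => a fa mina; case: (ex_minnP (ex g g0)) => b gb minb.
have := congr1 (fun h => fps_coef h (a + b)%N) fg0; rewrite /= => /eqP.
rewrite -[in X in X -> _]/(fps_coef (fps_mul f g) (a + b)%N == 0) /= if_same.
have la : (a < (a + b).+1)%N by rewrite ltnS leq_addr.
rewrite (bigD1 (Ordinal la)) //= addKn big1 ?addr0 ?mulf_eq0.
  by rewrite (negPf fa) (negPf gb).
move=> i; rewrite -val_eqE /= => nia.
have [lia|] := ltnP i a.
  have -> : fps_coef f i = 0; last by rewrite mul0r.
  by apply/eqP/negPn/negP => /mina; rewrite leqNgt lia.
rewrite leq_eqVlt eq_sym (negPf nia) /= => lai.
have -> : fps_coef g (a + b - i)%N = 0; last by rewrite mulr0.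
apply/eqP/negPn/negP => /minb; rewrite leqNgt ltn_subLR; last first.
  by rewrite -ltnS ltn_ord.
by rewrite ltn_add2r lai.
Qed.

HB.instance Definition _ :=
  GRing.ComUnitRing_isIntegral.Build (fps R) fps_integral.

End FpsDomain.

Local Open Scope classical_set_scope.
Local Open Scope complex_scope.

Section PadicFields.
Variables (R : realType) (p : nat) (K : closedFieldType) (nrm : K -> R).

(* The closure of Q in K, i.e. Q_p. *)
Definition in_Qp (x : K) : Prop :=
  forall eps : R, 0 < eps -> exists q : rat, nrm (x - ratr q) < eps.

(* (K, nrm) is an algebraic closure of Q_p with the absolute value such that
   |p| = 1/p; these properties determine (K, nrm) up to isomorphism. *)
Record padic_closure : Prop := PadicClosure {
  nrm_ge0 : forall x, 0 <= nrm x;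
  nrm_eq0 : forall x, nrm x = 0 <-> x = 0;
  nrmM : forall x y, nrm (x * y) = nrm x * nrm y;
  nrm_ultra : forall x y, nrm (x + y) <= Num.max (nrm x) (nrm y);
  nrm_p : nrm p%:R = p%:R^-1;
  Qp_complete : forall u : nat -> rat,
    (forall eps : R, 0 < eps -> exists n0, forall i j,
       (n0 <= i)%N -> (n0 <= j)%N -> nrm (ratr (u i) - ratr (u j)) < eps) ->
    exists x, forall eps : R, 0 < eps -> exists n0, forall i,
       (n0 <= i)%N -> nrm (ratr (u i) - x) < eps;
  Qp_algebraic : forall x, exists q : {poly K},
    [/\ q != 0, (forall i, in_Qp q`_i) & root q x] }.

(* O (embedded in K by iO) is the ring of integers of a finite extension E of
   Q_p inside K. *)
Definition padic_integers (O : idomainType) (iO : {rmorphism O -> K}) : Prop :=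
  injective iO /\
  exists (E : {pred K}) (d : nat) (b : 'I_d -> K),
    [/\ divring_closed E,
        (forall x, in_Qp x -> x \in E),
        (forall x, x \in E -> exists c : 'I_d -> K,
           (forall i, in_Qp (c i)) /\ x = \sum_i c i * b i)
      & forall x, (exists c, iO c = x) <-> (x \in E /\ nrm x <= 1)].

End PadicFields.

(* Every ring endomorphism of the algebraic closure algC of Q is bijective, so
   this is the absolute Galois group of Q; equality in the group is =1. *)
Notation GQ := {rmorphism algC -> algC}.

Definition prime_above (l : nat) (I : {pred algC}) : Prop :=
  [/\ {subset I <= Aint},
      (0 \in I) /\ {in I &, forall x y, x + y \in I},
      (forall x y, x \in Aint -> y \in I -> x * y \in I),
      (l%:R \in I) /\ (1 \notin I)
    & {in Aint &, forall x y, x * y \in I -> (x \in I) || (y \in I)}].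

Definition is_inertia (l : nat) (s : GQ) : Prop :=
  exists2 I, prime_above l I & {in Aint, forall x, s x - x \in I}.

(* Arithmetic Frobenius elements. *)
Definition is_frob (l : nat) (s : GQ) : Prop :=
  exists2 I, prime_above l I & {in Aint, forall x, s x - x ^+ l \in I}.

Definition galois_rep (F : fieldType) (n : nat) (rho : GQ -> 'M[F]_n) : Prop :=
  (forall s : GQ, s =1 id -> rho s = 1%:M) /\
  (forall s t u : GQ, u =1 s \o t -> rho u = rho s *m rho t).

Definition unramified_outside (F : fieldType) (n D : nat)
    (rho : GQ -> 'M[F]_n) : Prop :=
  forall l, prime l -> ~~ (l %| D)%N ->
  forall s, is_inertia l s -> rho s = 1%:M.

(* A basic open subgroup of the Krull topology: the elements fixing X. *)
Definition fixes (X : seq algC) (s : GQ) : Prop := {in X, forall x, s x = x}.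

Definition dirichlet_char (M : nat) (chi : int -> algC) : Prop :=
  [/\ (forall a b, (a = b %[mod M])%Z -> chi a = chi b),
      (forall a b, chi (a * b) = chi a * chi b)
    & (forall a, (chi a != 0) = coprimez a M)].

Section ModularForms.
Variable R : realType.
Notation C := (R[i]).

(* exp(2 pi i n tau) *)
Definition qpow (n : nat) (tau : C) : C :=
  let x := complex.Re tau in let y := complex.Im tau in
  (expR (- (2 * pi * n%:R * y)) * cos (2 * pi * n%:R * x))
  +i* (expR (- (2 * pi * n%:R * y)) * sin (2 * pi * n%:R * x)).

Definition mobius (a b c d : int) (tau : C) : C :=
  (a%:~R * tau + b%:~R) / (c%:~R * tau + d%:~R).

(* a is the q-expansion at infinity of an element of M_k(Gamma_0(M), chi). *)
Definition modular_form (k M : nat) (chi : int -> C) (a : nat -> C) : Prop :=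
  exists f : C -> C,
  [/\ (forall tau, 0 < complex.Im tau -> derivable (f : C^o -> C^o) tau 1),
      (forall tau, 0 < complex.Im tau ->
         series (fun n => a n * qpow n tau : C^o) @ \oo --> (f tau : C^o)),
      (forall (x y z t : int) tau, x * t - y * z = 1 -> (M %| z)%Z ->
         0 < complex.Im tau ->
         f (mobius x y z t tau) = chi t * (z%:~R * tau + t%:~R) ^+ k * f tau)
    & (forall x y z t : int, x * t - y * z = 1 ->
         exists B : C, forall tau, 1 <= complex.Im tau ->
           `| (z%:~R * tau + t%:~R) ^- k * f (mobius x y z t tau) | <= B)].

End ModularForms.

Inductive hecke_op := HeckeT of nat | HeckeS of nat | HeckeU of nat.

(* The generators of the Hecke algebras of level N p^r, r > 0, for D = N p. *)
Definition hecke_op_ok (D : nat) (h : hecke_op) : bool :=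
  match h with
  | HeckeT l | HeckeS l => prime l && ~~ (l %| D)
  | HeckeU l => prime l && (l %| D)
  end%N.

Definition hecke_act (F : fieldType) (k : nat) (chi : int -> F)
    (h : hecke_op) (a : nat -> F) : nat -> F :=
  match h with
  | HeckeT l => fun n => a (l * n)%N +
      (if (l %| n)%N then chi l * l%:R ^+ k / l%:R * a (n %/ l)%N else 0)
  | HeckeS l => fun n => chi l * l%:R ^+ k / l%:R ^+ 2 * a n
  | HeckeU l => fun n => a (l * n)%N
  end.

Definition qexp := nat -> algC.

(* f is a normalized eigenform of weight k, of level N p^r for some r > 0, with
   Nebentypus chi, for all T_l (l not dividing N p) and U_l (l dividing N p).
   Its coefficients are viewed in C through iinf. *)
Definition classical_eigenform (R : realType) (iinf : {rmorphism algC -> R[i]})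
    (N p k : nat) (f : qexp) (chi : int -> algC) : Prop :=
  exists2 r, (0 < r)%N &
  [/\ dirichlet_char (N * p ^ r) chi,
      modular_form k (N * p ^ r) (iinf \o chi) (iinf \o f),
      f 1%N = 1,
      (forall l, hecke_op_ok (N * p) (HeckeT l) -> forall n,
         hecke_act k chi (HeckeT l) f n = f l * f n)
    & (forall l, hecke_op_ok (N * p) (HeckeU l) -> forall n,
         hecke_act k chi (HeckeU l) f n = f l * f n)].

Definition char_field (chi : int -> algC) (x : algC) : Prop :=
  forall S : {pred algC}, divring_closed S -> (forall n, chi n \in S) -> x \in S.

Definition galois_conjugates (f : qexp) (chi : int -> algC) : set qexp :=
  [set g | exists2 s : GQ,
     (forall x, char_field chi x -> s x = x) & g = (s \o f : qexp)].

Section Hida.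
Variables (R : realType) (p N : nat) (K : closedFieldType) (nrm : K -> R).
Variables (iinf : {rmorphism algC -> R[i]}) (ip : {rmorphism algC -> K}).
Variables (O : idomainType) (iO : {rmorphism O -> K}).

Notation Lambda := (fps O).

(* The K-span of the forms with algebraic coefficients, i.e.
   M_k(Gamma_0(M), chi; K). *)
Definition padic_modular_form (k M : nat) (chi : int -> algC)
    (F : nat -> K) : Prop :=
  exists (d : nat) (c : 'I_d -> K) (g : 'I_d -> qexp),
    (forall i, modular_form k M (iinf \o chi) (iinf \o g i)) /\
    (forall n, F n = \sum_i c i * ip (g i n)).

(* F lies in the sum of the generalized eigenspaces of U_p whose eigenvalues
   are p-adic units; (U_p^i F)(n) = F(p^i n). *)
Definition ordinary (F : nat -> K) : Prop :=
  exists h : {poly K},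
    [/\ h \is monic,
        (forall x, root h x -> nrm x = 1)
      & forall n, \sum_(i < size h) h`_i * F (p ^ i * n)%N = 0].

(* chi (of level N p^r) restricted to 1 + p Z_p is the character sending the
   generator 1 + p to zeta. *)
Definition wild_part (r : nat) (chi : int -> algC) (zeta : K) : Prop :=
  forall u : int, (u = 1 + p%:Z %[mod (p ^ r)%N])%Z -> (u = 1 %[mod N])%Z ->
    ip (chi u) = zeta.

(* phi is the arithmetic point of weight k and wild character given by zeta:
   the O-algebra morphism with 1 + T |-> zeta (1 + p)^(k - 2). The power k - 2
   matches S_l = l^(k-2) <l>. *)
Definition arithmetic_point (k : nat) (zeta : K)
    (phi : {rmorphism Lambda -> K}) : Prop :=
  (forall c, phi (fpsC c) = iO c) /\
  phi (1 + fpsX O) = zeta * (1 + p%:R) ^+ (k - 2).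

Section Algebra.
Variables (H : comAlgType Lambda) (T S U : nat -> H).

Definition hecke_gen (h : hecke_op) : H :=
  match h with HeckeT l => T l | HeckeS l => S l | HeckeU l => U l end.

(* At every arithmetic point phi of weight k >= 2, K (x)_(Lambda, phi) H is the
   algebra of Hecke operators on the ordinary forms of weight k, tame level N
   and the given wild character: a K-linear combination of monomials in the
   Hecke operators vanishes in one iff it vanishes in the other. As H is free
   of finite rank over Lambda, an element of K (x) H is zero iff every
   Lambda-linear form on H kills it. *)
Definition interpolates_ordinary : Prop :=
  forall (k e : nat) (zeta : K) (phi : {rmorphism Lambda -> K}),
  (2 <= k)%N -> zeta ^+ (p ^ e) = 1 -> arithmetic_point k zeta phi ->
  forall s : seq (K * seq hecke_op),
  all (fun cw => all (hecke_op_ok (N * p)) cw.2) s ->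
  (forall psi : {linear H -> Lambda^o},
     \sum_(cw <- s) cw.1 * phi (psi (\prod_(h <- cw.2) hecke_gen h)) = 0)
  <->
  (forall (r : nat) (chi : int -> algC) (F : nat -> K),
     (0 < r)%N -> dirichlet_char (N * p ^ r) chi -> wild_part r chi zeta ->
     padic_modular_form k (N * p ^ r) chi F -> ordinary F ->
     forall n, \sum_(cw <- s)
       cw.1 * foldr (hecke_act k (ip \o chi)) F cw.2 n = 0).

(* H, with its elements T_l, S_l (l not dividing N p) and U_l (l dividing N p),
   is the universal p-ordinary Hecke algebra of tame level N; these properties
   determine (H, T, S, U) up to unique isomorphism. *)
Record hida_hecke_algebra : Prop := HidaHeckeAlgebra {
  hida_free : exists (d : nat) (b : 'I_d -> H),
    forall x, exists! c : {ffun 'I_d -> Lambda}, x = \sum_i c i *: b i;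
  hida_generated : forall A : {pred H},
    GRing.subalg_closed A ->
    (forall h, hecke_op_ok (N * p) h -> hecke_gen h \in A) ->
    forall x, x \in A;
  hida_interpolates : interpolates_ordinary }.

(* pr : H -> J is the quotient by a minimal prime. *)
Definition irreducible_component (J : idomainType) (pr : {rmorphism H -> J})
    : Prop :=
  (forall y, exists x, pr x = y) /\
  (forall Q : {pred H}, idealr_closed Q -> prime_idealr_closed Q ->
     (forall x, x \in Q -> pr x = 0) -> forall x, pr x = 0 -> x \in Q).

Definition has_eigensystem (P : H -> K) (k : nat) (f : qexp)
    (chi : int -> algC) : Prop :=
  forall l, prime l ->
    if (l %| N * p)%N then P (U l) = ip (f l)
    else P (T l) = ip (f l) /\ P (S l) = ip (chi l) * l%:R ^+ k / l%:R ^+ 2.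

(* rho is the p-adic Galois representation of the eigenform f. *)
Record attached_rep (k : nat) (f : qexp) (chi : int -> algC)
    (rho : GQ -> 'M[K]_2) : Prop := AttachedRep {
  attached_hom : galois_rep rho;
  attached_cont : forall eps : R, 0 < eps -> exists X, forall s, fixes X s ->
    forall i j, nrm (rho s i j - (i == j)%:R) < eps;
  attached_semisimple : forall V : 'M[K]_2, (forall s, stablemx V (rho s)) ->
    exists W : 'M[K]_2, [/\ (forall s, stablemx W (rho s)),
      (V + W :=: 1%:M)%MS & (V :&: W = 0)%MS];
  attached_unram : unramified_outside (N * p) rho;
  attached_frob : forall l, prime l -> ~~ (l %| N * p)%N ->
    forall s, is_frob l s ->
    char_poly (rho s) = 'X^2 - (ip (f l))%:P * 'X
                        + (ip (chi l) * l%:R ^+ (k - 1))%:P }.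

Section Component.
Variables (J : idomainType) (pr : {rmorphism H -> J}).

Let algJ (x : Lambda) : {fraction J} := tofrac (pr x%:A).

(* Continuity in Hida's sense: rho stabilizes a J-lattice in Frac(J)^2 (spanned
   by the columns of B) on which it acts continuously for the topology defined
   by the maximal ideal; (p^n, T^n) is a basis of neighbourhoods of 0. *)
Definition lattice_continuous (rho : GQ -> 'M[{fraction J}]_2) : Prop :=
  exists (d : nat) (B : 'M[{fraction J}]_(2, d)),
  [/\ \rank B = 2%N,
      (forall s, exists A : 'M[J]_d,
         rho s *m B = B *m map_mx (@tofrac J) A)
    & forall n : nat, exists X, forall s, fixes X s ->
      exists A A' : 'M[J]_d,
        rho s *m B - B = p%:R ^+ n *: (B *m map_mx (@tofrac J) A)
                         + algJ (fpsX O) ^+ n *: (B *m map_mx (@tofrac J) A')].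

(* rho is Hida's Galois representation attached to the component J. As rho need
   not take values in the localization of J at a given point P, its
   specialization at P is expressed on characteristic polynomials. *)
Record hida_rep (rho : GQ -> 'M[{fraction J}]_2) : Prop := HidaRep {
  hida_rep_hom : galois_rep rho;
  hida_rep_cont : lattice_continuous rho;
  hida_rep_unram : unramified_outside (N * p) rho;
  hida_rep_frob : forall l, prime l -> ~~ (l %| N * p)%N ->
    forall s, is_frob l s ->
    char_poly (rho s) = 'X^2 - (tofrac (pr (T l)))%:P * 'X
                        + (tofrac (pr (l%:R * S l)))%:P;
  hida_rep_spec : forall (P : {rmorphism J -> K}) (k : nat) (f : qexp)
      (chi : int -> algC),
    (forall c : O, P (pr (fpsC c)%:A) = iO c) ->
    (0 < k)%N -> classical_eigenform iinf N p k f chi ->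
    has_eigensystem (P \o pr) k f chi ->
    exists2 rhof, attached_rep k f chi rhof &
      forall s, exists2 q : {poly J},
        char_poly (rho s) = map_poly (@tofrac J) q &
        char_poly (rhof s) = map_poly P q }.

End Component.
End Algebra.
End Hida.

Definition integral_closure (A : idomainType)
    (L : fieldExtType {fraction A}) (M : comAlgType A)
    (jM : {rmorphism M -> L}) : Prop :=
  [/\ injective jM,
      (forall a : A, jM a%:A = (tofrac a)%:A)
    & forall y : L, integralOver (fun a : A => (tofrac a)%:A : L) y <->
                    exists x, jM x = y].

Section Localization.
Variables (A : comNzRingType) (F E : fieldType) (j : A -> F) (P : A -> E).

(* With j injective: x lies in the localization of A at ker P, inside F. *)
Definition in_loc (x : F) : Prop :=
  exists a s, P s != 0 /\ x = j a / j s.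

(* The extension of P to that localization (0 elsewhere). *)
Definition loc_ext (x : F) : E :=
  xget 0 [set y | exists a s, [/\ P s != 0, x = j a / j s & y = P a / P s]].

Definition in_GL_loc (n : nat) (B : 'M[F]_n) : Prop :=
  (forall u v, in_loc (B u v)) /\ in_loc (\det B)^-1.

End Localization.

(* Main.v *)
Require Import Defs.
From HB Require Import structures.
From mathcomp Require Import all_boot all_order all_algebra all_field.
From mathcomp Require Import complex fraction.
From mathcomp Require Import all_classical all_reals all_analysis.

(* On the direct sum r of the Hida representations, the characteristic
   polynomial of Frob_l has coefficients in M and specializes at P_f to
   prod_i (X^2 - a_l(f_i) X + eps(l)), the weight one determinant being eps(l).
   An automorphism of Qbar fixing Q(eps) permutes the conjugates f_i, hence
   fixes this product, and Galois theory for the number field Q(eps) concludes. *)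

Set Implicit Arguments.
Unset Strict Implicit.
Unset Printing Implicit Defensive.

Import GRing.Theory Num.Theory.

Local Open Scope ring_scope.
Local Open Scope complex_scope.

(** * Specializing characteristic polynomials through a localization *)

Section LocalizationTheory.
Variables (A : comNzRingType) (F E : fieldType).
Variables (j : {rmorphism A -> F}) (P : {rmorphism A -> E}).
Hypothesis j_inj : injective j.

(* The graph of the extension of P to the localization: loc_ext is a morphism
   only there, so compatibilities are stated for this relation instead. *)
Definition loc_rel (x : F) (y : E) : Prop :=
  exists a s, [/\ P s != 0, x = j a / j s & y = P a / P s].

Lemma loc_den_neq0 s : P s != 0 -> j s != 0.
Proof.
apply: contra_neq => /eqP; rewrite raddf_eq0 // => /eqP ->.
by rewrite rmorph0.
Qed.

(** Equal fractions in [F] cross-multiply to an equality in [A], by injectivity of [j], and [P]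
    carries it to [E]. This makes the extension of [P] well defined. *)
Lemma loc_rel_fun x y z : loc_rel x y -> loc_rel x z -> y = z.
Proof.
move=> [a [s [Ps -> ->]]] [b [t [Pt + ->]]] => /eqP.
rewrite eqr_div ?loc_den_neq0 // -!rmorphM => /eqP/j_inj ab.
by apply/eqP; rewrite eqr_div // -!rmorphM ab.
Qed.

Lemma loc_relE x y : loc_rel x y -> loc_ext j P x = y.
Proof.
move=> xy; rewrite /loc_ext; case: xgetP => [z _|/(_ y)//].
by move/loc_rel_fun; apply.
Qed.

Lemma loc_rel_ext x : in_loc j P x -> loc_rel x (loc_ext j P x).
Proof.
move=> [a [s [Ps ->]]].
have h : loc_rel (j a / j s) (P a / P s) by exists a, s.
by rewrite (loc_relE h).
Qed.

Lemma loc_rel_img a : loc_rel (j a) (P a).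
Proof. by exists a, 1; rewrite !rmorph1 !divr1 oner_eq0. Qed.

Lemma loc_relD x x' y y' :
  loc_rel x x' -> loc_rel y y' -> loc_rel (x + y) (x' + y').
Proof.
move=> [a [s [Ps -> ->]]] [b [t [Pt -> ->]]].
exists (a * t + b * s), (s * t).
by rewrite !rmorphD !rmorphM mulf_neq0 // !addf_div ?loc_den_neq0.
Qed.

Lemma loc_relM x x' y y' :
  loc_rel x x' -> loc_rel y y' -> loc_rel (x * y) (x' * y').
Proof.
move=> [a [s [Ps -> ->]]] [b [t [Pt -> ->]]].
by exists (a * b), (s * t); rewrite !rmorphM mulf_neq0 // !mulf_div.
Qed.

(** The coefficients are ring expressions in the entries, and the relation respects ring operations.
    It is extended coefficientwise to polynomials and followed through the expansion of the
    determinant. *)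
Lemma loc_rel_char_poly n (B : 'M[F]_n) (B' : 'M[E]_n) :
  (forall u v, loc_rel (B u v) (B' u v)) ->
  forall i, loc_rel (char_poly B)`_i (char_poly B')`_i.
Proof.
pose polyR (p : {poly F}) (q : {poly E}) := forall i, loc_rel p`_i q`_i.
have R0 : loc_rel 0 0 by rewrite -(rmorph0 j) -(rmorph0 P); apply: loc_rel_img.
have RN1 : loc_rel (-1) (-1).
  by rewrite -(rmorphN1 j) -(rmorphN1 P); apply: loc_rel_img.
have Rnat k : loc_rel k%:R k%:R.
  by rewrite -(rmorph_nat j) -(rmorph_nat P); apply: loc_rel_img.
have pD p p' q q' : polyR p p' -> polyR q q' -> polyR (p + q) (p' + q').
  by move=> hp hq i; rewrite !coefD; apply: loc_relD.
have pM p p' q q' : polyR p p' -> polyR q q' -> polyR (p * q) (p' * q').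
  move=> hp hq i; rewrite !coefM; apply: (big_ind2 loc_rel) => //.
    by move=> *; apply: loc_relD.
  by move=> k _; apply: loc_relM.
have pC c c' : loc_rel c c' -> polyR c%:P c'%:P.
  by move=> hc i; rewrite !coefC; case: ifP.
have pX : polyR 'X 'X by move=> i; rewrite !coefX.
(* The entries of [char_poly_mx] involve ['X *+ (i == j)]. *)
have pMn p p' k : polyR p p' -> polyR (p *+ k) (p' *+ k).
  move=> hp; rewrite -[p *+ k]mulr_natr -[p' *+ k]mulr_natr.
  by apply: pM => //; rewrite -!polyC_natr; apply: pC.
have pN1 : polyR (-1) (-1) by have := pC _ _ RN1; rewrite !polyCN.
have pN p p' : polyR p p' -> polyR (- p) (- p').
  by move=> hp; rewrite -[- p]mulN1r -[- p']mulN1r; apply: pM.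
have p1 : polyR 1 1 by apply: (pC 1 1 (Rnat 1%N)).
move=> hB; rewrite -/(polyR _ _) /char_poly /determinant.
apply: (big_ind2 polyR) => [||s _]; first exact: (pC 0 0).
  by move=> *; apply: pD.
apply: (pM); first by case: (perm.odd_perm s); rewrite ?expr0 ?expr1.
apply: (big_ind2 polyR) => // i _.
rewrite !mxE; apply: pD; first exact: pMn.
by apply/pN/pC.
Qed.

(** Reads the specialized polynomial off a lift [q] over [A], although the entries of [B] are only
    fractions. It serves twice: to carry each [rho i] into [L], and to specialize at [P f]. *)
Lemma loc_ext_char_poly n (B : 'M[F]_n) (q : {poly A}) :
  (forall u v, in_loc j P (B u v)) -> char_poly B = map_poly j q ->
  char_poly (map_mx (loc_ext j P) B) = map_poly P q.
Proof.
move=> hB hq; apply/polyP => i; rewrite coef_map /=.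
apply: (@loc_rel_fun (j q`_i)); last exact: loc_rel_img.
rewrite -coef_map /= -hq; apply: loc_rel_char_poly => u v.
by rewrite mxE; apply: loc_rel_ext.
Qed.

End LocalizationTheory.

(** * Characteristic polynomials of direct sums *)

Lemma char_poly_mxdiag (R : comNzRingType) m (n_ : 'I_m -> nat)
    (B : forall i, 'M[R]_(n_ i)) :
  char_poly (\mxdiag_i B i) = \prod_i char_poly (B i).
Proof.
elim: m n_ B => [|m IH] n_ B.
  rewrite [RHS]big_ord0 /char_poly; move: (char_poly_mx _).
  by rewrite big_ord0 => D; apply: det_mx00.
rewrite [RHS]big_ord_recl -IH mxdiag_recl.
have char_poly_cast a b (e : a = b) (C : 'M[R]_a) :
  char_poly (castmx (e, e) C) = char_poly C by case: b / e; rewrite castmx_id.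
rewrite char_poly_cast /char_poly /char_poly_mx map_block_mx !map_mx0.
by rewrite scalar_mx_block opp_block_mx add_block_mx !oppr0 !addr0 det_ublock.
Qed.

(** * Galois descent inside [algC] *)

Lemma rpred_Fadjoin_seq (Qn : fieldExtType rat) (QnC : {rmorphism Qn -> algC})
    (S : divringClosed algC) (t : seq Qn) (x : Qn) :
  {in t, forall y, QnC y \in S} -> x \in <<1 & t>>%VS -> QnC x \in S.
Proof.
elim/last_ind: t x => [|t y IH] x tS.
  rewrite adjoin_nil subfield_closed => /vlineP[a ->].
  by rewrite rmorphZ_num rmorph1 mulr1 rpred_rat.
(* An element of the last simple extension is a polynomial in [y] over the field generated by [t],
   where the induction hypothesis applies. *)
rewrite adjoin_rcons => /Fadjoin_polyP[q /polyOverP tq ->].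
rewrite -horner_map rpred_horner //; last first.
  by apply: tS; rewrite mem_rcons mem_head.
apply/polyOverP => i; rewrite coef_map; apply: IH => // z zt.
by apply: tS; rewrite mem_rcons inE zt orbT.
Qed.

(* x and s lie in a number field Qr that is normal over Q, so that the elements
   of Gal(Qr / Q(s)) extend to automorphisms of algC. *)
Lemma fixed_by_algC_aut (s : seq algC) (x : algC) (S : {pred algC}) :
  (forall nu : GQ, {in s, forall y, nu y = y} -> nu x = x) ->
  divring_closed S -> {subset s <= S} -> x \in S.
Proof.
move=> fix_x S_closed sS.
pose SC : divringClosed algC :=
  HB.pack S (GRing.isDivringClosed.Build algC S S_closed).
(* [p] is the product of the minimal polynomials of [x] and of the elements of [s]; [Qr] will be its
   splitting field. *)
have [p p0 rp] : exists2 p : {poly rat}, p != 0 &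
    {in x :: s, forall y, root (map_poly ratr p) y}.
  elim: (x :: s) => [|y t [p p0 pt]]; first by exists 1; rewrite ?oner_eq0.
  have [q [_ q_mon] qy] := minCpolyP y.
  exists (q * p) => [|z]; first by rewrite mulf_neq0 ?(monic_neq0 q_mon).
  rewrite inE rmorphM rootM => /orP[/eqP->|/pt ->]; last by rewrite orbT.
  by rewrite qy dvdpp.
have [r Dr] := closed_field_poly_normal (map_poly ratr p : {poly algC}).
have lc0 : lead_coef (map_poly ratr p : {poly algC}) != 0.
  by rewrite lead_coef_eq0 map_poly_eq0.
have xsr : {subset x :: s <= r}.
  by move=> y /rp; rewrite Dr rootZ // root_prod_XsubC.
have [Qr [QrC [rr Drr genQr]]] := num_field_exists r.
pose pr := map_poly (in_alg Qr) p.
have Qpr : pr \is a polyOver 1%AS.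
  by apply/polyOverP=> i; rewrite coef_map memvZ ?memv_line.
have prC : map_poly QrC pr = map_poly ratr p.
  rewrite -map_poly_comp; apply: eq_map_poly => a /=.
  by rewrite rmorphZ_num rmorph1 mulr1.
have splitQr : splittingFieldFor 1%AS pr {:Qr}.
  exists rr => //; rewrite -(eqp_map QrC) prC Dr.
  rewrite -Drr big_map rmorph_prod /=.
  under [X in _ %= X]eq_bigr do rewrite map_polyXsubC.
  by rewrite eqp_scale.
have Qr_ax : FieldExt_isSplittingField _ Qr by constructor; exists pr.
pose Qn : splittingFieldType rat :=
  HB.pack_for (splittingFieldType rat) Qr Qr_ax.
pose QnC : {rmorphism Qn -> algC} := QrC.
have galQn : galois 1%AS {:Qn}.
  apply/and3P; split; first exact: sub1v.
    apply/separableP => y _; apply: pcharf0_separable => k.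
    by rewrite pchar_lalg pchar_num.
  by apply/splitting_normalField; rewrite ?sub1v //; exists pr.
have lift_s : forall t : seq algC, {subset t <= r} ->
    exists t1 : seq Qn, map QnC t1 = t.
  elim=> [|y t IH] yt; first by exists [::].
  have [|t1 Dt1] := IH; first by move=> z zt; apply: yt; rewrite inE zt orbT.
  have := yt y (mem_head _ _); rewrite -Drr => /mapP[y1 _ Dy].
  by exists (y1 :: t1); rewrite /= Dt1 Dy.
have [[|x1 s1] //= [Dx Ds]] := lift_s _ xsr.
pose E := <<1 & s1>>%AS.
(* By the Galois correspondence it suffices that each [g] fixing [E] fixes [x1]. Such a [g] extends
   to an automorphism [nu] of [algC], which fixes [s], hence [x]. *)
have x1E : x1 \in E.
  have galE : galois E {:Qn} by apply: galoisS galQn; rewrite sub1v subvf.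
  rewrite -(galois_fixedField galE); apply/fixedFieldP; first exact: memvf.
  move=> g gE; have [nu Dnu] := extend_algC_subfield_aut QnC g.
  apply: (fmorph_inj QnC); rewrite Dnu Dx; apply: fix_x => y.
  rewrite -Ds => /mapP[y1 y1s ->]; rewrite -Dnu; congr (QnC _).
  by apply: (fixed_gal (subvf E) gE); apply: seqv_sub_adjoin.
rewrite -Dx; apply: (rpred_Fadjoin_seq (S := SC) _ x1E) => y ys.
by apply: sS; rewrite -Ds map_f.
Qed.

(** * Representatives in a fraction field *)

Lemma tofrac_surj (A : idomainType) (x : {fraction A}) :
  exists a s, s != 0 /\ x = tofrac a / tofrac s.
Proof.
elim/quotW: x => y; exists (frac y).1, (frac y).2; split.
  exact: denom_ratioP.
apply: (canRL (mulfK _)); first by rewrite tofrac_eq0 denom_ratioP.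
unlock tofrac; rewrite -[LHS]FracField.pi_mul; apply/eqmodP.
rewrite /= FracField.equivfE /FracField.mulf.
by rewrite !numden_Ratio ?mulf_neq0 ?oner_eq0 ?denom_ratioP // !mulr1 mulrC.
Qed.

(** * Character fields and Galois conjugates *)

Lemma dirichlet_char_values M (chi : int -> algC) :
  (0 < M)%N -> dirichlet_char M chi ->
  exists s : seq algC, forall y, (y \in s) <-> exists n, chi n = y.
Proof.
move=> M0 [chi_mod _ _]; exists [seq chi (Posz i) | i <- iota 0 M] => y; split.
  by move=> /mapP[i _ ->]; exists i.
move=> [n <-]; have nM0 : (0 <= n %% M)%Z by rewrite modz_ge0 // -lt0n.
apply/mapP; exists `|n %% M|%Z%N.
  by rewrite mem_iota /= -ltz_nat gez0_abs // ltz_pmod.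
by apply: chi_mod; rewrite gez0_abs // modz_mod.
Qed.

(** By periodicity [chi] has finitely many values, so its field is generated by a finite list and
    [fixed_by_algC_aut] applies. *)
Lemma char_field_fixed M (chi : int -> algC) (x : algC) :
  (0 < M)%N -> dirichlet_char M chi ->
  (forall nu : GQ, (forall y, char_field chi y -> nu y = y) -> nu x = x) ->
  char_field chi x.
Proof.
move=> M0 chiM fix_x S S_closed chiS.
have [s sP] := dirichlet_char_values M0 chiM.
apply: (@fixed_by_algC_aut s) => // [nu fix_s|y /sP[n <-] //].
(* The elements fixed by [nu] form a field containing the values of [chi], hence the whole character
   field. *)
apply: fix_x => y /(_ [pred z | nu z == z]) nu_y; apply/eqP/nu_y.
  split=> [|u v|u v] /=; rewrite !inE ?rmorph1 // => /eqP nu_u /eqP nu_v.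
    by rewrite rmorphB /= nu_u nu_v.
  by rewrite fmorph_div /= nu_u nu_v.
by move=> n; rewrite inE fix_s //; apply/sP; exists n.
Qed.

Lemma map_poly_quadratic (A B : comNzRingType) (h : {rmorphism A -> B})
    (t d : A) :
  map_poly h ('X^2 - t%:P * 'X + d%:P) = 'X^2 - (h t)%:P * 'X + (h d)%:P.
Proof.
rewrite rmorphD rmorphB rmorphXn /= [X in _ - X]rmorphM /=.
by rewrite !map_polyX !map_polyC.
Qed.

(** Composition with [nu] sends conjugates to conjugates, and injectively; on a finite set this is a
    permutation, so the factors are merely reindexed. *)
Lemma prod_conjugates_fixed (chi : int -> algC) (f : qexp) m
    (fs : 'I_m -> qexp) (c : int) l (nu : GQ) :
  injective fs -> range fs = galois_conjugates f chi ->
  (forall y, char_field chi y -> nu y = y) ->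
  map_poly nu (\prod_i ('X^2 - (fs i l)%:P * 'X + (chi c)%:P)) =
  \prod_i ('X^2 - (fs i l)%:P * 'X + (chi c)%:P).
Proof.
move=> fs_inj fs_conj nu_fix.
have nu_conj i : exists k, fs k = nu \o fs i.
  have : galois_conjugates f chi (fs i) by rewrite -fs_conj; exists i.
  move=> [t t_fix Dfi].
  have : galois_conjugates f chi (nu \o fs i).
    exists (nu \o t : GQ) => [y y_chi|]; last by rewrite Dfi.
    by rewrite /= t_fix ?nu_fix.
  by rewrite -fs_conj => -[k _ <-]; exists k.
pose h i := projT1 (cid (nu_conj i)).
have Dh i : fs (h i) = nu \o fs i by rewrite /h; case: cid.
have h_inj : injective h.
  move=> i k ik; apply: fs_inj; apply: funext => n.
  by apply: (fmorph_inj nu); have := Dh i; rewrite ik Dh => /(congr1 (@^~ n)).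
rewrite rmorph_prod [RHS](reindex_inj h_inj); apply: eq_bigr => i _ /=.
by rewrite map_poly_quadratic Dh /= (nu_fix (chi c)) // => S _; apply.
Qed.

(** * The Frobenius polynomial of the direct sum and its specialization *)

Theorem theorem5p3
  (* p, the tame level N, and an algebraic closure K of Q_p *)
  (R : realType) (p N : nat)
  (p_prime : prime p) (p_odd : odd p) (N_gt0 : (0 < N)%N)
  (pN : ~~ (p %| N)%N)
  (K : closedFieldType) (nrm : K -> R) (hK : padic_closure p nrm)
  (iinf : {rmorphism algC -> R[i]}) (ip : {rmorphism algC -> K})
  (* Lambda = fps O and the ordinary Hecke algebra H *)
  (O : idomainType) (iO : {rmorphism O -> K}) (hO : padic_integers nrm iO)
  (H : comAlgType (fps O)) (T S U : nat -> H)
  (hH : hida_hecke_algebra p N nrm iinf ip iO T S U)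
  (* the components I_1, ..., I_m *)
  (m : nat) (I : 'I_m -> idomainType) (pr : forall i, {rmorphism H -> I i})
  (hI : forall i, irreducible_component (pr i))
  (* M, the integral closure of Lambda in L, and the embeddings e_i *)
  (L : splittingFieldType {fraction (fps O)})
  (L_galois : galois 1%AS {:L}%AS)
  (M : comAlgType (fps O)) (jM : {rmorphism M -> L})
  (hM : integral_closure jM)
  (e : forall i, {rmorphism I i -> M})
  (e_inj : forall i, injective (e i))
  (e_alg : forall i (a : fps O), e i (pr i a%:A) = a%:A)
  (* the infinite set Rset of weight one eigenforms *)
  (Rset : set qexp) (Rset_inf : infinite_set Rset)
  (eps : qexp -> int -> algC)
  (Rset_eigen : forall f, Rset f -> classical_eigenform iinf N p 1 f (eps f))
  (* fs f 0, ..., fs f (m - 1) are the distinct Galois conjugates of f *)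
  (fs : qexp -> 'I_m -> qexp)
  (fs_inj : forall f, Rset f -> injective (fs f))
  (fs_conj : forall f, Rset f ->
     range (fs f) = galois_conjugates f (eps f))
  (fs_first : forall f, Rset f -> forall i, val i = 0%N -> fs f i = f)
  (* the points P_f *)
  (P : qexp -> {rmorphism M -> K})
  (P_alg : forall f, Rset f -> forall c : O, P f (fpsC c)%:A = iO c)
  (P_spec : forall f, Rset f -> forall i,
     has_eigensystem p N ip T S U (P f \o e i \o pr i) 1 (fs f i) (eps f))
  (* r, the direct sum of the rho_i *)
  (rho : forall i, GQ -> 'M[{fraction (I i)}]_2)
  (rho_hida : forall i, hida_rep p N nrm iinf ip iO T S U (pr i) (rho i))
  (r : GQ -> 'M[L]_(\sum_(i < m) 2))
  (r_sum : forall s, r s =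
     \mxdiag_(i < m)
        map_mx (loc_ext (@tofrac (I i)) (fun x => jM (e i x))) (rho i s))
  (r_loc : forall f, Rset f -> forall s, in_GL_loc jM (P f) (r s)) :
  forall f, Rset f -> forall l : nat, prime l -> ~~ (l %| N * p)%N ->
  forall s : GQ, is_frob l s ->
  let r_f := fun t : GQ => map_mx (loc_ext jM (P f)) (r t) in
  forall n : nat, exists2 x : algC,
    char_field (eps f) x & (char_poly (r_f s))`_n = ip x.
Proof.
move=> f Rf l l_prime lNp s s_frob r_f n.
have [r0 _ [eps_dir _ _ _ _]] := Rset_eigen f Rf.
have M0 : (0 < N * p ^ r0)%N by rewrite muln_gt0 N_gt0 expn_gt0 prime_gt0.
have [jM_inj _ _] := hM.
(* The product of Hida's Frobenius polynomials, moved into [M] by the [e i]: its coefficients lie in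
   [M] itself, so [P f] applies to them directly. *)
pose Q : {poly M} := \prod_(i < m)
  ('X^2 - (e i (pr i (T l)))%:P * 'X + (e i (pr i (l%:R * S l)))%:P).
pose q : {poly algC} := \prod_(i < m)
  ('X^2 - (fs f i l)%:P * 'X + (eps f l)%:P).
have r_Q : char_poly (r s) = map_poly jM Q.
  rewrite r_sum char_poly_mxdiag rmorph_prod; apply: eq_bigr => i _.
  pose g : {rmorphism I i -> L} := jM \o e i.
  have g_inj : injective g := inj_comp jM_inj (@e_inj i).
  rewrite (@loc_ext_char_poly _ _ _ (@tofrac (I i)) g _ _ _
     ('X^2 - (pr i (T l))%:P * 'X + (pr i (l%:R * S l))%:P)).
  - by rewrite [RHS]map_poly_quadratic [LHS]map_poly_quadratic.
  - by move=> x y /eqP; rewrite tofrac_eq => /eqP.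
  (* As [g] is injective, the localization at its kernel is the whole fraction field, so the default
     value of [loc_ext] never occurs here. *)
  - move=> u v; have [a [t [t0 ->]]] := tofrac_surj (rho i s u v).
    by exists a, t; rewrite raddf_eq0.
  - rewrite (hida_rep_frob (rho_hida i) l_prime lNp s_frob).
    by rewrite map_poly_quadratic.
have rf_Q : char_poly (r_f s) = map_poly (P f) Q.
  by apply: loc_ext_char_poly => // u v; have [] := r_loc f Rf s.
have Q_q : map_poly (P f) Q = map_poly ip q.
  rewrite !rmorph_prod; apply: eq_bigr => i _ /=.
  have := P_spec f Rf i l l_prime; rewrite (negPf lNp) => -[PT PS].
  rewrite [LHS]map_poly_quadratic [RHS]map_poly_quadratic -PT; congr (_ + _%:P).
  (* In weight one [S l] specializes to [eps f l * l / l ^ 2], so cancelling [l] turns [l%:R * S l]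
     into [eps f l]. *)
  have l0 : l%:R != 0 :> K.
    by rewrite -(rmorph_nat ip) fmorph_eq0 pnatr_eq0 -lt0n prime_gt0.
  rewrite !rmorphM !rmorph_nat /=; move: PS => /= ->; rewrite expr1 expr2.
  by rewrite -mulf_div divff // mulr1 mulrC divfK.
exists q`_n; last by rewrite rf_Q Q_q coef_map.
apply: (char_field_fixed M0 eps_dir) => nu nu_fix.
by rewrite -coef_map (prod_conjugates_fixed _ _ (fs_inj f Rf) (fs_conj f Rf)).
Qed.
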